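(* Fix a Mellin moment $z$ and let $\gamma(\mu)=\begin{pmatrix}\gamma_{qq}&\gamma_{qg}\\ \gamma_{gq}&\gamma_{gg}\end{pmatrix}$ be the singlet-gluon block of the DGLAP kernel, with $\gamma_{qg},\gamma_{gq}$ nonvanishing on the range of scales considered. Let a prime denote $d/d\ln\mu^2$. Let $u_{qq}$ and $u_{gg}$ be solutions of the linear second-order equations $$u_{qq}''-\Big(\gamma_{gg}-\gamma_{qq}+\frac{\gamma_{qg}'}{\gamma_{qg}}\Big)u_{qq}'-\gamma_{qg}\gamma_{gq}\,u_{qq}=0,\qquad u_{gg}''-\Big(\gamma_{qq}-\gamma_{gg}+\frac{\gamma_{gq}'}{\gamma_{gq}}\Big)u_{gg}'-\gamma_{qg}\gamma_{gq}\,u_{gg}=0 ,$$ and set $\omega_{q}(\mu)=\exp\big(-\int_{\mu_0^2}^{\mu^2}d\ln\mu'^2\,\gamma_{qq}(\mu')\big)$, $\omega_{g}(\mu)=\exp\big(-\int_{\mu_0^2}^{\mu^2}d\ln\mu'^2\,\gamma_{gg}(\mu')\big)$ and $$\mathcal K_0(\mu)=\begin{pmatrix}-\dfrac{u_{qq}'}{\gamma_{qg}}\,\omega_g&u_{qq}\,\omega_g\\[6pt] u_{gg}\,\omega_q&-\dfrac{u_{gg}'}{\gamma_{gq}}\,\omega_q\end{pmatrix},\qquad W=u_{qq}'u_{gg}'-\gamma_{qg}\gamma_{gq}\,u_{qq}u_{gg}.$$ Then: (i) $\mathcal K_0'=-\mathcal K_0\gamma$, i.e. $\mathcal K_0$ gauges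 the kernel to zero; (ii) $\big(W/(\gamma_{qg}\gamma_{gq})\big)'=0$, so that $u_{gg}$ follows from $u_{qq}$ by a single quadrature; (iii) $\det\mathcal K_0$ is a constant multiple of $\exp\big(-\int_{\mu_0^2}^{\mu^2} d\ln\mu'^2\,\mathrm{Tr}\,\gamma\big)$, so it never vanishes if it is nonzero at the input scale $\mu_0$; (iv) if $\det\mathcal K_0(\mu_0)\neq0$, the solution of the evolution equation $\overline f\,'=\gamma\,\overline f$ for $\overline f=(\overline\Sigma_+,\overline g)^T$ is $\overline f(\mu)=\mathcal K_0^{-1}(\mu)\,\mathcal K_0(\mu_0)\,\overline f(\mu_0)$.
   Context: $\overline\Sigma_+$ and $\overline g$ are the Mellin moments (at fixed complex $z$) of the quark-singlet and gluon densities, whose evolution in the scale $\mu$ is the $2\times2$ linear system $\frac{d}{d\ln\mu^2}\overline f=\gamma\overline f$. The entries of $\gamma$ are differentiable complex-valued functions of $\ln\mu^2$. A change of scheme $\overline f\mapsto\mathcal K\overline f$ transforms the kernel as $\gamma\mapsto\mathcal K\gamma\mathcal K^{-1}+\mathcal K'\mathcal K^{-1}$; gauging the kernel to zero means that the transformed kernel vanishes. *)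

(* Defs.v *)
(* Based on MathComp, MathComp-Analysis and mathcomp-real-closed. *)
From mathcomp Require Import all_boot all_order all_algebra complex.
From mathcomp Require Import all_classical all_reals all_analysis.

Set Implicit Arguments.
Unset Strict Implicit.
Unset Printing Implicit Defensive.

Import Order.TTheory GRing.Theory Num.Theory.
Import numFieldNormedType.Exports.

Local Open Scope classical_set_scope.
Local Open Scope ring_scope.
Local Open Scope complex_scope.

(* Every function of the scale mu is taken as a function of the real variable
   t = ln mu^2, so that a prime (d / d ln mu^2) is the derivative in t, the
   measure d ln mu'^2 is Lebesgue measure, and t0 = ln mu_0^2. *)

Section ComplexCalculus.
Context {R : realType}.

(* R[i] has no normed-module structure over R in these libraries: functions
   R -> R[i] are differentiated and integrated componentwise. *)

Definition cderivable (f : R -> R[i]) (t : R) : Prop :=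
  derivable (fun s => complex.Re (f s)) t 1 /\
  derivable (fun s => complex.Im (f s)) t 1.

(* Meaningful only where [f] is [cderivable]. *)
Definition cderiv (f : R -> R[i]) (t : R) : R[i] :=
  derive1 (fun s => complex.Re (f s)) t +i* derive1 (fun s => complex.Im (f s)) t.

Definition is_cderiv (f : R -> R[i]) (t : R) (l : R[i]) : Prop :=
  cderivable f t /\ cderiv f t = l.

Definition mxderivable m n (M : R -> 'M[R[i]]_(m, n)) (t : R) : Prop :=
  forall i j, cderivable (fun s => M s i j) t.

Definition mxderiv m n (M : R -> 'M[R[i]]_(m, n)) (t : R) : 'M[R[i]]_(m, n) :=
  \matrix_(i, j) cderiv (fun s => M s i j) t.

Definition is_mxderiv m n (M : R -> 'M[R[i]]_(m, n)) (t : R)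
    (L : 'M[R[i]]_(m, n)) : Prop :=
  mxderivable M t /\ mxderiv M t = L.

(* Oriented integral: the bounds may come in either order. *)
Definition oint (f : R -> R) (a b : R) : R :=
  if a <= b then \int[lebesgue_measure]_(x in `[a, b]) f x
  else - \int[lebesgue_measure]_(x in `[b, a]) f x.

Definition cint (f : R -> R[i]) (a b : R) : R[i] :=
  oint (fun s => complex.Re (f s)) a b +i* oint (fun s => complex.Im (f s)) a b.

Definition cexp (w : R[i]) : R[i] :=
  (expR (complex.Re w) * cos (complex.Im w)) +i*
  (expR (complex.Re w) * sin (complex.Im w)).

End ComplexCalculus.

(* Row and column indices of the singlet-gluon block. *)
Definition qk : 'I_2 := 0.
Definition gl : 'I_2 := 1.

Section Gauge.
Context {R : realType}.
Implicit Types (gam K : R -> 'M[R[i]]_2) (uqq ugg : R -> R[i]) (t : R).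

Definition mx22 (a b c d : R[i]) : 'M[R[i]]_2 :=
  \matrix_(i, j) if i == qk then (if j == qk then a else b)
                 else (if j == qk then c else d).

Definition gauge_transform K gam t : 'M[R[i]]_2 :=
  K t *m gam t *m invmx (K t) + mxderiv K t *m invmx (K t).

(* [omega t0 gam qk] is omega_q and [omega t0 gam gl] is omega_g. *)
Definition omega t0 gam (i : 'I_2) t : R[i] :=
  cexp (- cint (fun s => gam s i i) t0 t).

(* u'' - (gam_bb - gam_aa + gam_ab' / gam_ab) u' - gam_qg gam_gq u = 0, which
   is the equation for u_qq at (a, b) = (q, g) and for u_gg at (g, q). *)
Definition second_order_eq gam (a b : 'I_2) (u : R -> R[i]) t : Prop :=
  [/\ cderivable u t, cderivable (cderiv u) t &
      cderiv (cderiv u) t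
      - (gam t b b - gam t a a
         + cderiv (fun s => gam s a b) t / gam t a b) * cderiv u t
      - gam t qk gl * gam t gl qk * u t = 0].

Definition K0 t0 gam uqq ugg t : 'M[R[i]]_2 :=
  mx22 (- (cderiv uqq t / gam t qk gl) * omega t0 gam gl t)
       (uqq t * omega t0 gam gl t)
       (ugg t * omega t0 gam qk t)
       (- (cderiv ugg t / gam t gl qk) * omega t0 gam qk t).

Definition W gam uqq ugg t : R[i] :=
  cderiv uqq t * cderiv ugg t - gam t qk gl * gam t gl qk * uqq t * ugg t.

(* Given u_qq, the identity W = C gam_qg gam_gq is a first-order linear
   equation for u_gg. Where u_qq' does not vanish, the equation for u_qq gives
   it the integrating factor gam_qg omega_q / (u_qq' omega_g), and [quad_ugg]
   is its solution with value [c] at [t1]. *)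
Definition quad_ugg t0 gam uqq (C c : R[i]) t1 t : R[i] :=
  let h s := cderiv uqq s * omega t0 gam gl s
             / (gam s qk gl * omega t0 gam qk s) in
  h t * (c / h t1
         + C * cint (fun s => gam s qk gl * gam s gl qk
                              / (cderiv uqq s * h s)) t1 t).

End Gauge.

(* Main.v *)
(** The quotients p = u_qq' / gam_qg and r = u_gg' / gam_gq satisfy first-order
    equations in which the derivatives of gam_qg and gam_gq have dropped out,
    and omega_a' = - gam_aa omega_a; this gives K0' = - K0 gam entrywise. The
    same equations give (p r - u_qq u_gg)' = 0, and p r - u_qq u_gg is both
    W / (gam_qg gam_gq) and det K0 / (omega_q omega_g), whence (ii) and (iii).
    The quadrature integrates (u_gg / h)' = W / (u_qq' h), with h as in
    [quad_ugg]. For (iv), K0 f has zero derivative exactly when f' = gam f. *)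
Require Import Defs.
From mathcomp Require Import all_boot all_order all_algebra complex ring.
From mathcomp Require Import all_classical all_reals all_analysis.

Import Order.TTheory GRing.Theory Num.Theory.
Import numFieldNormedType.Exports.

Local Open Scope classical_set_scope.
Local Open Scope ring_scope.

(** * Fundamental theorem of calculus for oriented real integrals *)

Section Real.
Set Implicit Arguments.
Unset Strict Implicit.
Context {R : realType}.
Implicit Types (f F : R -> R) (I J : set R).

(** Derivatives on [J] are two-sided even at [a] and [b], so [F] is continuous there; this supplies
    the one-sided limits that [continuous_FTC2] asks for. *)
Lemma FTC2_lt J f F a b : is_interval J -> J a -> J b -> a < b ->
  (forall s, J s -> {for s, continuous f}) ->
  (forall s, J s -> is_derive s 1 F (f s)) ->
  \int[lebesgue_measure]_(x in `[a, b]) f x = F b - F a.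
Proof.
move=> iJ Ja Jb ab cf dF.
have sJ s : a <= s <= b -> J s by move=> h; apply: iJ h.
have cF s : J s -> {for s, continuous F}.
  by move=> Js; have [dv _] := dF _ Js; apply/differentiable_continuous/derivable1_diffP.
rewrite /Rintegral (@continuous_FTC2 _ f F)//=.
- apply: continuous_in_subspaceT => s; rewrite inE/= in_itv/= => sab.
  by apply: cf; apply: sJ.
- split=> [s sab||].
  + have Js : J s by apply: sJ; move: sab; rewrite in_itv/= => /andP[/ltW-> /ltW->].
    by have [] := dF s Js.
  + exact/cvg_at_right_filter/cF.
  + exact/cvg_at_left_filter/cF.
- move=> s; rewrite in_itv/= => /andP[/ltW as_ /ltW sb].
  have Js : J s by apply/sJ/andP.
  by have [_ <-] := dF s Js; rewrite derive1E.
Qed.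

Lemma oint_FTC2 J f F a b : is_interval J -> J a -> J b ->
  (forall s, J s -> {for s, continuous f}) ->
  (forall s, J s -> is_derive s 1 F (f s)) ->
  oint f a b = F b - F a.
Proof.
move=> iJ Ja Jb cf dF; rewrite /oint; case: ltgtP => [ab|ba|<-].
- exact: (@FTC2_lt J).
- by rewrite (@FTC2_lt J _ F)// opprB.
- by rewrite set_itv1 Rintegral_set1 subrr.
Qed.

Lemma open_interval_room I s : open I -> I s ->
  exists a b, [/\ I a, I b, a < s & s < b].
Proof.
move=> oI Is.
have /nbhs_ballP[e /= e0 eI] : nbhs s I by apply: open_nbhs_nbhs.
have he : 0 < e / 2 by rewrite divr_gt0.
have h2 : e / 2 < e by rewrite gtr_pMr// invf_lt1// ltr1n.
exists (s - e / 2), (s + e / 2); split.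
- by apply: eI; rewrite /ball/= opprB addrC subrK ger0_norm// ltW.
- by apply: eI; rewrite /ball/= opprD addrA subrr add0r normrN ger0_norm// ltW.
- by rewrite gtrBl.
- by rewrite ltrDl.
Qed.

(** Openness gives a base point [a] in [I] strictly below both [t0] and [t]. With [F] the integral
    from [a], the oriented integral is [F y - F t0] for [y] near [t], whatever the order of [t0] and
    [t]. *)
Lemma oint_FTC1 I f t0 t : open I -> is_interval I ->
  (forall s, I s -> {for s, continuous f}) -> I t0 -> I t ->
  is_derive t 1 (oint f t0) (f t).
Proof.
move=> oI iI cf It0 It.
have Im : I (Order.min t0 t) by rewrite /Order.min; case: ifP.
have IM : I (Order.max t0 t) by rewrite /Order.max; case: ifP.
have [a [_ [Ia _ am _]]] := open_interval_room oI Im.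
have [_ [b [_ Ib _ Mb]]] := open_interval_room oI IM.
move: am Mb; rewrite lt_min gt_max => /andP[at0 at_] /andP[t0b tb].
pose F y := \int[lebesgue_measure]_(x in `[a, y]) f x.
have sI s : a <= s <= b -> I s by move=> h; apply: iI h.
have intf : lebesgue_measure.-integrable `[a, b] (EFin \o f).
  apply: continuous_compact_integrable; first exact: segment_compact.
  apply: continuous_in_subspaceT => s; rewrite inE/= in_itv/= => sab.
  by apply: cf; apply: sI.
have dF s : a < s < b -> is_derive s 1 F (f s).
  move=> /andP[as_ sb].
  have [//|dv <-] := continuous_FTC1_closed sb intf as_; last first.
    by rewrite derive1E; apply: derivableP.
  by apply: cf; apply: sI; rewrite !ltW.
have dFt : is_derive t 1 (fun y => F y - F t0) (f t).
  have := dF t; rewrite at_ tb => /(_ isT) dFt.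
  by rewrite -[f t]subr0; apply: is_deriveB.
apply: near_eq_is_derive dFt; near=> y.
rewrite (@oint_FTC2 `]a, b[ f F)//=.
- exact: interval_is_interval.
- by rewrite in_itv/= at0.
- by near: y; apply: near_in_itvoo; rewrite in_itv/= at_.
- by move=> s; rewrite in_itv/= => /andP[? ?]; apply/cf/sI; rewrite !ltW.
Unshelve. all: by end_near. Qed.

End Real.

Local Open Scope complex_scope.

(** * Differentiation and integration of complex functions of a real variable *)

Section ComplexCalculus.
Set Implicit Arguments.
Unset Strict Implicit.
Context {R : realType}.
Implicit Types (f g F : R -> R[i]) (t : R) (I J : set R).
Local Notation Re := complex.Re.
Local Notation Im := complex.Im.

(** Bridge to the real [is_derive], through which the rules below are proved on real and imaginary
    parts. *)
Lemma is_cderivP f t l : is_cderiv f t l <->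
  is_derive t 1 (fun s => Re (f s)) (Re l) /\ is_derive t 1 (fun s => Im (f s)) (Im l).
Proof.
split=> [[[dr di] <-]|[dr di]].
  by rewrite /cderiv/= !derive1E; split; apply: derivableP.
split; first by split; [case: dr|case: di].
by rewrite /cderiv !derive1E !derive_val; case: l {dr di}.
Qed.

Lemma cderivableP f t : cderivable f t -> is_cderiv f t (cderiv f t).
Proof. by []. Qed.

Lemma is_cderiv_derivable f t l : is_cderiv f t l -> cderivable f t.
Proof. by case. Qed.

Lemma is_cderiv_eq f t l l' : is_cderiv f t l -> l = l' -> is_cderiv f t l'.
Proof. by move=> ? <-. Qed.

(** Derivatives are local. This allows differentiating identities that hold only on [I], such as
    those that divide by entries of [gam]. *)
Lemma is_cderiv_near I f g t l : open I -> I t -> (forall s, I s -> f s = g s) ->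
  is_cderiv f t l -> is_cderiv g t l.
Proof.
move=> oI It fg /is_cderivP[dr di].
have nI : \forall s \near t, I s by apply: open_nbhs_nbhs.
by apply/is_cderivP; split; [apply: near_eq_is_derive dr|apply: near_eq_is_derive di];
  near=> s; rewrite fg//; near: s.
Unshelve. all: by end_near. Qed.

Lemma is_cderiv_cst (c : R[i]) t : is_cderiv (fun=> c) t 0.
Proof. by apply/is_cderivP; split; apply: is_derive_cst. Qed.

Lemma ReD (x y : R[i]) : Re (x + y) = Re x + Re y. Proof. by case: x; case: y. Qed.
Lemma ImD (x y : R[i]) : Im (x + y) = Im x + Im y. Proof. by case: x; case: y. Qed.
Lemma ReN (x : R[i]) : Re (- x) = - Re x. Proof. by case: x. Qed.
Lemma ImN (x : R[i]) : Im (- x) = - Im x. Proof. by case: x. Qed.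
Lemma ReM (x y : R[i]) : Re (x * y) = Re x * Re y - Im x * Im y.
Proof. by case: x; case: y. Qed.
Lemma ImM (x y : R[i]) : Im (x * y) = Re x * Im y + Im x * Re y.
Proof. by case: x; case: y. Qed.
Lemma ReV (x : R[i]) : Re x^-1 = Re x / (Re x ^+ 2 + Im x ^+ 2).
Proof. by case: x. Qed.
Lemma ImV (x : R[i]) : Im x^-1 = - (Im x / (Re x ^+ 2 + Im x ^+ 2)).
Proof. by case: x. Qed.

Lemma is_cderivD f g t l m : is_cderiv f t l -> is_cderiv g t m ->
  is_cderiv (fun s => f s + g s) t (l + m).
Proof.
move=> /is_cderivP[fr fi] /is_cderivP[gr gi]; apply/is_cderivP; rewrite ReD ImD; split.
- by under eq_fun do rewrite ReD; apply: is_deriveD.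
- by under eq_fun do rewrite ImD; apply: is_deriveD.
Qed.

Lemma is_cderivN f t l : is_cderiv f t l -> is_cderiv (fun s => - f s) t (- l).
Proof.
move=> /is_cderivP[fr fi]; apply/is_cderivP; rewrite ReN ImN; split.
- by under eq_fun do rewrite ReN; apply: is_deriveN.
- by under eq_fun do rewrite ImN; apply: is_deriveN.
Qed.

Lemma is_cderivB f g t l m : is_cderiv f t l -> is_cderiv g t m ->
  is_cderiv (fun s => f s - g s) t (l - m).
Proof. by move=> df dg; apply/is_cderivD/is_cderivN. Qed.

Lemma is_cderivM f g t l m : is_cderiv f t l -> is_cderiv g t m ->
  is_cderiv (fun s => f s * g s) t (l * g t + f t * m).
Proof.
move=> /is_cderivP[fr fi] /is_cderivP[gr gi]; apply/is_cderivP; split.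
- under eq_fun do rewrite ReM.
  apply: is_derive_eq (is_deriveB (is_deriveM fr gr) (is_deriveM fi gi)) _.
  by rewrite /GRing.scale/= ReD !ReM; ring.
- under eq_fun do rewrite ImM.
  apply: is_derive_eq (is_deriveD (is_deriveM fr gi) (is_deriveM fi gr)) _.
  by rewrite /GRing.scale/= ImD !ImM; ring.
Qed.

Lemma is_cderivV f t l : f t != 0 -> is_cderiv f t l ->
  is_cderiv (fun s => (f s)^-1) t (- (l / f t ^+ 2)).
Proof.
move=> ft0 /is_cderivP[fr fi].
(* [n] is the squared modulus of [f], the common denominator of both components of the inverse. *)
pose n s := Re (f s) ^+ 2 + Im (f s) ^+ 2.
have nt0 : n t != 0.
  apply: contra ft0; rewrite /n paddr_eq0 ?sqr_ge0// !sqrf_eq0.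
  by rewrite eq_complex.
have dn := is_deriveD (is_deriveM fr fr) (is_deriveM fi fi).
have dV := @is_deriveV _ n _ _ _ nt0 dn.
apply/is_cderivP; split.
- under eq_fun do rewrite ReV.
  apply: is_derive_eq (is_deriveM fr dV) _.
  rewrite /GRing.scale/= ReN ReM ReV ImV expr2 ReM ImM.
  move: nt0; rewrite /n; move: (Re (f t)) (Im (f t)) => a b ab.
  (* The denominator of the inverse of [f t ^+ 2] is its squared modulus, which is the square of the
     squared modulus of [f t]; [field] needs it nonzero. *)
  have ab2 : (a * a - b * b) ^+ 2 + (a * b + b * a) ^+ 2 != 0.
    have -> : (a * a - b * b) ^+ 2 + (a * b + b * a) ^+ 2 = (a ^+ 2 + b ^+ 2) ^+ 2 by ring.
    by rewrite sqrf_eq0.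
  by field; rewrite -?expr2 ab ab2.
- under eq_fun do rewrite ImV.
  apply: is_derive_eq (is_deriveN (is_deriveM fi dV)) _.
  rewrite /GRing.scale/= ImN ImM ReV ImV expr2 ReM ImM.
  move: nt0; rewrite /n; move: (Re (f t)) (Im (f t)) => a b ab.
  have ab2 : (a * a - b * b) ^+ 2 + (a * b + b * a) ^+ 2 != 0.
    have -> : (a * a - b * b) ^+ 2 + (a * b + b * a) ^+ 2 = (a ^+ 2 + b ^+ 2) ^+ 2 by ring.
    by rewrite sqrf_eq0.
  by field; rewrite -?expr2 ab ab2.
Qed.

Lemma cexp0 : cexp 0 = 1 :> R[i].
Proof. by rewrite /cexp/= expR0 cos0 sin0 mulr1 mulr0. Qed.

Lemma cexpD (z w : R[i]) : cexp (z + w) = cexp z * cexp w.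
Proof.
rewrite /cexp ReD ImD expRD cosD sinD.
by apply/eqP; rewrite eq_complex ReM ImM /=; apply/andP; split; apply/eqP; ring.
Qed.

Lemma cexp_neq0 (z : R[i]) : cexp z != 0.
Proof.
apply/eqP => z0; have : cexp z * cexp (- z) = 1 by rewrite -cexpD subrr cexp0.
by rewrite z0 mul0r => /esym/eqP; rewrite oner_eq0.
Qed.

Lemma is_cderiv_cexp f t l : is_cderiv f t l ->
  is_cderiv (fun s => cexp (f s)) t (l * cexp (f t)).
Proof.
move=> /is_cderivP[fr fi]; rewrite /cexp; apply/is_cderivP.
have dE := is_derive1_comp (is_derive_expR (Re (f t))) fr.
split=> /=.
- apply: is_derive_eq (is_deriveM dE (is_derive1_comp (is_derive_cos (Im (f t))) fi)) _.
  by rewrite /GRing.scale/= ReM/=; ring.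
- apply: is_derive_eq (is_deriveM dE (is_derive1_comp (is_derive_sin (Im (f t))) fi)) _.
  by rewrite /GRing.scale/= ImM/=; ring.
Qed.

Lemma cderivable_continuous f t : cderivable f t ->
  {for t, continuous (fun s => Re (f s))} /\ {for t, continuous (fun s => Im (f s))}.
Proof. by move=> [? ?]; split; apply/differentiable_continuous/derivable1_diffP. Qed.

Lemma cint_FTC2 J f F a b : is_interval J -> J a -> J b ->
  (forall s, J s -> cderivable f s) -> (forall s, J s -> is_cderiv F s (f s)) ->
  cint f a b = F b - F a.
Proof.
move=> iJ Ja Jb df dF; apply/eqP; rewrite eq_complex /cint/= ReD ImD ReN ImN.
apply/andP; split; apply/eqP.
- apply: (@oint_FTC2 _ J _ (fun s => Re (F s))) => // s Js.
  + by have [] := cderivable_continuous (df s Js).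
  + by have [] := (is_cderivP _ _ _).1 (dF s Js).
- apply: (@oint_FTC2 _ J _ (fun s => Im (F s))) => // s Js.
  + by have [] := cderivable_continuous (df s Js).
  + by have [] := (is_cderivP _ _ _).1 (dF s Js).
Qed.

Lemma cint_FTC1 I f t0 t : open I -> is_interval I ->
  (forall s, I s -> cderivable f s) -> I t0 -> I t ->
  is_cderiv (cint f t0) t (f t).
Proof.
move=> oI iI df It0 It; apply/is_cderivP; split.
- apply: (@oint_FTC1 _ I (fun s => Re (f s))) => // s Is.
  by have [] := cderivable_continuous (df s Is).
- apply: (@oint_FTC1 _ I (fun s => Im (f s))) => // s Is.
  by have [] := cderivable_continuous (df s Is).
Qed.

Lemma cint_diag f t : cint f t t = 0.
Proof. by rewrite /cint /oint lexx !set_itv1 !Rintegral_set1. Qed.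

(** Both [F] and the constant 0 are antiderivatives of the zero function, so its integral equals
    both [F b - F a] and 0. *)
Lemma is_cderiv0_cst J F a b : is_interval J -> J a -> J b ->
  (forall s, J s -> is_cderiv F s 0) -> F b = F a.
Proof.
move=> iJ Ja Jb dF; apply/eqP; rewrite -subr_eq0; apply/eqP.
have d0 s : cderivable (fun=> 0 : R[i]) s := is_cderiv_derivable (is_cderiv_cst 0 s).
rewrite -(@cint_FTC2 J (fun=> 0))// (@cint_FTC2 J _ (fun=> 0)) ?subrr// => s _.
exact: is_cderiv_cst.
Qed.

(** For [c] nonzero, [c^-1 * F] is an antiderivative of [g]; for [c = 0], [F] is constant and both
    sides vanish. The second case serves the quadrature when W is zero. *)
Lemma cint_FTC2Z J g F (c : R[i]) a b : is_interval J -> J a -> J b ->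
  (forall s, J s -> cderivable g s) -> (forall s, J s -> is_cderiv F s (c * g s)) ->
  c * cint g a b = F b - F a.
Proof.
move=> iJ Ja Jb dg; have [-> dF|c0 dF] := eqVneq c 0.
  rewrite mul0r (@is_cderiv0_cst J F a b) ?subrr// => s Js.
  by rewrite -(mul0r (g s)); apply: dF.
rewrite (@cint_FTC2 J g (fun s => c^-1 * F s))// -?mulrBr ?mulVKf// => s Js.
apply: is_cderiv_eq (is_cderivM (is_cderiv_cst _ _) (dF s Js)) _.
by rewrite mul0r add0r mulKf.
Qed.

End ComplexCalculus.

(** * Matrix-valued functions: products, determinants and inverses *)

Section MatrixCalculus.
Set Implicit Arguments.
Unset Strict Implicit.
Context {R : realType}.
Implicit Types (t : R) (I : set R).
Local Open Scope complex_scope.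

Lemma is_cderiv_sum (T : Type) (r : seq T) (f : T -> R -> R[i]) (l : T -> R[i]) t :
  (forall i, is_cderiv (f i) t (l i)) ->
  is_cderiv (fun s => \sum_(i <- r) f i s) t (\sum_(i <- r) l i).
Proof.
move=> df; elim: r => [|i r IHr].
  by rewrite big_nil; under eq_fun do rewrite big_nil; apply: is_cderiv_cst.
by rewrite big_cons; under eq_fun do rewrite big_cons; apply: is_cderivD.
Qed.

Lemma cderivable_prod (T : Type) (r : seq T) (f : T -> R -> R[i]) t :
  (forall i, cderivable (f i) t) -> cderivable (fun s => \prod_(i <- r) f i s) t.
Proof.
move=> df; elim: r => [|i r IHr].
  by under eq_fun do rewrite big_nil; apply: is_cderiv_derivable (is_cderiv_cst _ _).
under eq_fun do rewrite big_cons.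
exact: is_cderiv_derivable (is_cderivM (cderivableP (df i)) (cderivableP IHr)).
Qed.

Lemma is_mxderivP m n (M : R -> 'M[R[i]]_(m, n)) t L :
  is_mxderiv M t L <-> forall i j, is_cderiv (fun s => M s i j) t (L i j).
Proof.
split=> [[dM <-] i j|dM]; first by split=> //; rewrite mxE.
split=> [i j|]; first by have [] := dM i j.
by apply/matrixP => i j; rewrite mxE; have [] := dM i j.
Qed.

Lemma is_mxderivM m n p (A : R -> 'M[R[i]]_(m, n)) (B : R -> 'M[R[i]]_(n, p)) t L M :
  is_mxderiv A t L -> is_mxderiv B t M ->
  is_mxderiv (fun s => A s *m B s) t (L *m B t + A t *m M).
Proof.
move=> /is_mxderivP dA /is_mxderivP dB; apply/is_mxderivP => i j.
under eq_fun do rewrite mxE.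
rewrite !mxE -big_split/=; apply: is_cderiv_sum => k.
exact: is_cderivM.
Qed.

Lemma is_mxderiv_cst m n (M : 'M[R[i]]_(m, n)) t : is_mxderiv (fun=> M) t 0.
Proof. by apply/is_mxderivP => i j; rewrite mxE; apply: is_cderiv_cst. Qed.

Lemma is_mxderiv_near I m n (A B : R -> 'M[R[i]]_(m, n)) t L : open I -> I t ->
  (forall s, I s -> A s = B s) -> is_mxderiv A t L -> is_mxderiv B t L.
Proof.
move=> oI It AB /is_mxderivP dA; apply/is_mxderivP => i j.
by apply: (is_cderiv_near oI It) (dA i j) => s Is; rewrite AB.
Qed.

Lemma is_mxderiv_unique m n (A : R -> 'M[R[i]]_(m, n)) t L M :
  is_mxderiv A t L -> is_mxderiv A t M -> L = M.
Proof. by move=> [_ <-] [_ <-]. Qed.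

Lemma is_mxderiv0_cst I m n (A : R -> 'M[R[i]]_(m, n)) a b : is_interval I ->
  I a -> I b -> (forall s, I s -> is_mxderiv A s 0) -> A b = A a.
Proof.
move=> iI Ia Ib dA; apply/matrixP => i j.
apply: (@is_cderiv0_cst _ I (fun s => A s i j)) => // s Is.
by have := (is_mxderivP _ _ _).1 (dA s Is) i j; rewrite mxE.
Qed.

(** By the Leibniz formula, the determinant is a signed sum of products of entries. *)
Lemma cderivable_det n (A : R -> 'M[R[i]]_n) t :
  mxderivable A t -> cderivable (fun s => \det (A s)) t.
Proof.
move=> dA; apply: is_cderiv_derivable (is_cderiv_sum _ _) => s.
apply: is_cderivM (is_cderiv_cst _ _) (cderivableP _).
exact: cderivable_prod.
Qed.

(** The entries of the adjugate are signed minors, hence determinants of submatrices. *)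
Lemma mxderivable_adj n (A : R -> 'M[R[i]]_n) t :
  mxderivable A t -> mxderivable (fun s => \adj (A s)) t.
Proof.
move=> dA i j; under eq_fun do rewrite mxE.
apply: is_cderiv_derivable (is_cderivM (is_cderiv_cst _ _) (cderivableP _)).
by apply: cderivable_det => k l; under eq_fun do rewrite !mxE; apply: dA.
Qed.

(* The formula comes from differentiating [A^-1 *m A = 1]; [I] is needed because
   [invmx A = A] on singular matrices. *)
Lemma is_mxderivV I n (A : R -> 'M[R[i]]_n) t L : open I -> I t ->
  (forall s, I s -> A s \in unitmx) -> is_mxderiv A t L ->
  is_mxderiv (fun s => invmx (A s)) t (- (invmx (A t) *m L *m invmx (A t))).
Proof.
move=> oI It uA dA.
(* The product rule presupposes that the inverse is differentiable; on [I] this comes from its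
   expression as the adjugate over the determinant. The value [M] is identified afterwards. *)
have [M dV] : exists M, is_mxderiv (fun s => invmx (A s)) t M.
  have dV : mxderivable (fun s => (\det (A s))^-1 *: \adj (A s)) t.
    move=> i j; under eq_fun do rewrite mxE.
    apply: is_cderiv_derivable (is_cderivM (is_cderivV _ (cderivableP _)) (cderivableP _)).
    - by have := uA t It; rewrite unitmxE unitfE.
    - by apply: cderivable_det; case: dA.
    - by apply: mxderivable_adj; case: dA.
  exists (mxderiv (fun s => (\det (A s))^-1 *: \adj (A s)) t).
  apply: (is_mxderiv_near oI It) (conj dV erefl) => s Is.
  by rewrite /invmx uA.
have d1 : is_mxderiv (fun s => invmx (A s) *m A s) t 0.
  apply: (is_mxderiv_near oI It) (is_mxderiv_cst 1%:M t) => s Is.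
  by rewrite mulVmx// uA.
have /(congr1 (mulmx^~ (invmx (A t)))) := is_mxderiv_unique (is_mxderivM dV dA) d1.
rewrite mul0mx mulmxDl mulmxK ?uA// => /eqP; rewrite addr_eq0 => /eqP <-.
exact: dV.
Qed.

End MatrixCalculus.

(** * The gauge matrix [K0] and the evolution equation *)

Section Gauge.
Set Implicit Arguments.
Unset Strict Implicit.
Local Open Scope complex_scope.

Lemma ord2P (P : 'I_2 -> Prop) : P qk -> P gl -> forall i, P i.
Proof.
move=> Pq Pg i; have /orP[/eqP->|/eqP->] // : (i == qk) || (i == gl).
by case: i => -[|[|]].
Qed.

Lemma big_ord2 (V : nmodType) (F : 'I_2 -> V) : \sum_i F i = F qk + F gl.
Proof.
rewrite !big_ord_recl big_ord0 addr0; congr (F _ + F _); exact: val_inj.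
Qed.

Context {R : realType} (I : set R) (t0 : R) (gam : R -> 'M[R[i]]_2).
Hypotheses (oI : open I) (iI : is_interval I) (It0 : I t0).
Hypothesis gam_der : forall t, I t -> mxderivable gam t.

Lemma det_mx22 (a b c d : R[i]) : \det (mx22 a b c d) = a * d - b * c.
Proof.
rewrite (expand_det_row _ qk) big_ord2 /cofactor !det_mx11 !mxE/=.
by rewrite expr0 mul1r expr1 mulN1r mulrN.
Qed.

Lemma omega_neq0 i t : omega t0 gam i t != 0.
Proof. exact: cexp_neq0. Qed.

Lemma is_cderiv_omega i t : I t ->
  is_cderiv (omega t0 gam i) t (- gam t i i * omega t0 gam i t).
Proof.
move=> It; apply/is_cderiv_cexp/is_cderivN.
by apply: (@cint_FTC1 _ I) => // s Is; apply: gam_der.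
Qed.

(** The sum [F] of the two diagonal integrals is an antiderivative of the trace that vanishes at
    [t0], so it is the integral of the trace. *)
Lemma cexp_tr t : I t ->
  cexp (- cint (fun s => \tr (gam s)) t0 t) = omega t0 gam qk t * omega t0 gam gl t.
Proof.
move=> It; rewrite -cexpD -opprD; congr (cexp (- _)).
pose F s := cint (fun s => gam s qk qk) t0 s + cint (fun s => gam s gl gl) t0 s.
have trE s : \tr (gam s) = gam s qk qk + gam s gl gl by rewrite /mxtrace big_ord2.
have dg i s : I s -> cderivable (fun s => gam s i i) s by move=> Is; apply: gam_der.
have -> := @cint_FTC2 _ I (fun s => \tr (gam s)) F t0 t iI It0 It.
- by rewrite /F !cint_diag addr0 subr0.
- move=> s Is; under eq_fun do rewrite trE.
  exact: is_cderiv_derivable (is_cderivD (cderivableP (dg _ _ Is)) (cderivableP (dg _ _ Is))).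
- by move=> s Is; rewrite trE; apply: is_cderivD; apply: (@cint_FTC1 _ I) => // r; apply: dg.
Qed.

(** The quotient rule produces the term - u' gam_ab' / gam_ab^2, which cancels the logarithmic
    derivative of gam_ab in the equation for u. *)
Lemma is_cderiv_ratio a b u t : mxderivable gam t -> gam t a b != 0 ->
  second_order_eq gam a b u t ->
  is_cderiv (fun s => cderiv u s / gam s a b) t
    ((gam t b b - gam t a a) * (cderiv u t / gam t a b)
     + gam t qk gl * gam t gl qk / gam t a b * u t).
Proof.
move=> dg g0 [du ddu /eqP]; rewrite subr_eq0 subr_eq => /eqP E.
apply: is_cderiv_eq (is_cderivM (cderivableP ddu)
  (is_cderivV g0 (cderivableP (dg a b)))) _.
by rewrite E; field.
Qed.

Context (uqq ugg : R -> R[i]).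
Hypothesis gam_qg : forall t, I t -> gam t qk gl != 0.
Hypothesis gam_gq : forall t, I t -> gam t gl qk != 0.
Hypothesis uqq_eq : forall t, I t -> second_order_eq gam qk gl uqq t.
Hypothesis ugg_eq : forall t, I t -> second_order_eq gam gl qk ugg t.

Let K := K0 t0 gam uqq ugg.
Let w t := W gam uqq ugg t / (gam t qk gl * gam t gl qk).

Lemma is_cderiv_ratio_qg t : I t -> is_cderiv (fun s => cderiv uqq s / gam s qk gl) t
  ((gam t gl gl - gam t qk qk) * (cderiv uqq t / gam t qk gl) + gam t gl qk * uqq t).
Proof.
move=> It; apply: is_cderiv_eq (is_cderiv_ratio _ _ (uqq_eq It)) _;
  [exact: gam_der|exact: gam_qg|].
by have := gam_qg It => ?; field.
Qed.

Lemma is_cderiv_ratio_gq t : I t -> is_cderiv (fun s => cderiv ugg s / gam s gl qk) t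
  ((gam t qk qk - gam t gl gl) * (cderiv ugg t / gam t gl qk) + gam t qk gl * ugg t).
Proof.
move=> It; apply: is_cderiv_eq (is_cderiv_ratio _ _ (ugg_eq It)) _;
  [exact: gam_der|exact: gam_gq|].
by have := gam_gq It => ?; field.
Qed.

(** Each row v of [K] solves v' = - v gam separately. In the first row, differentiating omega_g
    cancels the gam_gg term of the ratio equation on the diagonal and supplies the gam_gg term off
    it; the second row is the same with q and g exchanged. *)
Lemma is_mxderiv_K0 t : I t -> is_mxderiv K t (- (K t *m gam t)).
Proof.
move=> It.
have [du _ _] := uqq_eq It; have [dv _ _] := ugg_eq It.
have dp := is_cderiv_ratio_qg It; have dr := is_cderiv_ratio_gq It.
have oq := is_cderiv_omega qk It; have og := is_cderiv_omega gl It.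
have nqg := gam_qg It; have ngq := gam_gq It.
apply/is_mxderivP; apply: ord2P; apply: ord2P;
  rewrite mxE mxE big_ord2; under eq_fun do rewrite mxE/=; rewrite /K !mxE/=.
- by apply: is_cderiv_eq (is_cderivM (is_cderivN dp) og) _; field.
- by apply: is_cderiv_eq (is_cderivM (cderivableP du) og) _; field.
- by apply: is_cderiv_eq (is_cderivM (cderivableP dv) oq) _; field.
- by apply: is_cderiv_eq (is_cderivM (is_cderivN dr) oq) _; field.
Qed.

Lemma wronskianE t : I t ->
  w t = cderiv uqq t / gam t qk gl * (cderiv ugg t / gam t gl qk) - uqq t * ugg t.
Proof.
by move=> It; rewrite /w /W; have := gam_qg It; have := gam_gq It => ? ?; field; apply/andP.
Qed.

(** With p and r the two ratios, the terms in gam_gg - gam_qq cancel in (p r)', which leaves gam_gq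
    u_qq r + gam_qg p u_gg = u_qq u_gg' + u_qq' u_gg, the derivative of u_qq u_gg. *)
Lemma is_cderiv_wronskian t : I t -> is_cderiv w t 0.
Proof.
move=> It; apply: (is_cderiv_near oI It (fun s Is => esym (wronskianE Is))).
have [du _ _] := uqq_eq It; have [dv _ _] := ugg_eq It.
have nqg := gam_qg It; have ngq := gam_gq It.
apply: is_cderiv_eq (is_cderivB (is_cderivM (is_cderiv_ratio_qg It) (is_cderiv_ratio_gq It))
  (is_cderivM (cderivableP du) (cderivableP dv))) _.
move: nqg ngq; move: (gam t qk gl) (gam t gl qk) (gam t qk qk) (gam t gl gl) => a b c d.
move: (cderiv uqq t) (cderiv ugg t) (uqq t) (ugg t) => u' v' u v na nb.
by field; rewrite na nb.
Qed.

Lemma wronskian_cst s t : I s -> I t -> w t = w s.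
Proof. by move=> Is It; apply: (is_cderiv0_cst iI) => //; apply: is_cderiv_wronskian. Qed.

(** The exponential is 1 at [t0], so the constant [w t0] is the determinant at the input scale. *)
Lemma det_K0 t : I t ->
  \det (K t) = w t0 * cexp (- cint (fun s => \tr (gam s)) t0 t).
Proof.
move=> It; rewrite cexp_tr// -(wronskian_cst It0 It) wronskianE// det_mx22; ring.
Qed.

(** Variation of constants: [h] solves the homogeneous equation u_qq' v' = gam_qg gam_gq u_qq v, and
    the constancy of [w] makes the derivative of [ugg / h] explicit. *)
Lemma ugg_quadrature J : is_interval J -> J `<=` I -> (forall s, J s -> cderiv uqq s != 0) ->
  forall t1 t, J t1 -> J t -> ugg t = quad_ugg t0 gam uqq (w t1) (ugg t1) t1 t.
Proof.
move=> iJ JI u0 t1 t Jt1 Jt.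
pose h s := cderiv uqq s * omega t0 gam gl s / (gam s qk gl * omega t0 gam qk s).
rewrite -[quad_ugg _ _ _ _ _ _ _]/(h t * (ugg t1 / h t1 + w t1 *
  cint (fun s => gam s qk gl * gam s gl qk / (cderiv uqq s * h s)) t1 t)).
(* Written as p omega_g / omega_q with p = u_qq' / gam_qg, [h] can be differentiated by the
   first-order equation for p. The diagonal entries of [gam] then cancel. *)
have hE : h = fun s => cderiv uqq s / gam s qk gl * omega t0 gam gl s / omega t0 gam qk s.
  by apply/funext => s; rewrite /h invfM; ring.
have h0 s : J s -> h s != 0.
  move=> Js; rewrite /h !(mulf_neq0, invr_neq0) ?omega_neq0 ?u0 ?gam_qg//; exact: JI.
have dh s : J s -> is_cderiv h s (gam s qk gl * gam s gl qk * uqq s / cderiv uqq s * h s).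
  move=> /[dup] Js /JI Is; rewrite hE.
  have nu := u0 s Js; have nqg := gam_qg Is; have no := omega_neq0 qk s.
  apply: is_cderiv_eq (is_cderivM (is_cderivM (is_cderiv_ratio_qg Is) (is_cderiv_omega gl Is))
    (is_cderivV no (is_cderiv_omega qk Is))) _.
  by field; rewrite nu nqg no.
rewrite (@cint_FTC2Z _ J _ (fun s => ugg s / h s))//.
- have := h0 t Jt; move: (h t) (ugg t1 / h t1) (ugg t) => x y z x0.
  by field.
(* The integrand is differentiable, hence continuous, because u_qq' itself is differentiable. *)
- move=> s /[dup] Js /JI Is; have [_ ddu _] := uqq_eq Is.
  have dg a b := cderivableP (gam_der Is a b).
  apply: is_cderiv_derivable (is_cderivM (is_cderivM (dg _ _) (dg _ _))
    (is_cderivV _ (is_cderivM (cderivableP ddu) (dh s Js)))).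
  by rewrite mulf_neq0 ?u0 ?h0.
- move=> s /[dup] Js /JI Is; have [dv _ _] := ugg_eq Is.
  have nu := u0 s Js; have nqg := gam_qg Is; have ngq := gam_gq Is; have nh := h0 s Js.
  apply: is_cderiv_eq (is_cderivM (cderivableP dv) (is_cderivV nh (dh s Js))) _.
  (* The constant [w t1] is moved to the current point [s], where its expression in the ratios
     matches (u_gg / h)'. *)
  rewrite (wronskian_cst Is (JI _ Jt1)) wronskianE//.
  by field; rewrite nu nqg ngq nh.
Qed.

Lemma evolution_solution : \det (K t0) != 0 -> forall f : R -> 'cV[R[i]]_2,
  (forall t, I t -> is_mxderiv f t (gam t *m f t)) <->
  (forall t, I t -> f t = invmx (K t) *m K t0 *m f t0).
Proof.
move=> d0 f.
(* Invertibility propagates from [t0] to all of [I]: the constant [w t0] in [det_K0] cannot be zero,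
   as it would make the determinant vanish at [t0]. *)
have uK t : I t -> K t \in unitmx.
  move=> It; rewrite unitmxE unitfE det_K0// mulf_neq0 ?cexp_neq0//.
  by apply: contra d0; rewrite det_K0// => /eqP->; rewrite mul0r.
split=> [df t It|fE t It].
  have KfE : K t *m f t = K t0 *m f t0.
    apply: (@is_mxderiv0_cst _ I _ _ (fun s => K s *m f s)) => // s Is.
    have := is_mxderivM (is_mxderiv_K0 Is) (df s Is).
    by move: (K s) (gam s) (f s) => A G v; rewrite mulNmx mulmxA addNr.
  by rewrite -mulmxA -KfE mulKmx ?uK.
(* For the converse, K' = - K gam gives (K^-1)' = gam K^-1, so K^-1 applied to a constant vector
   solves the evolution equation. *)
apply: (is_mxderiv_near oI It (A := fun s => invmx (K s) *m (K t0 *m f t0))).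
  by move=> s Is; rewrite mulmxA -fE.
have := is_mxderivM (is_mxderivV oI It uK (is_mxderiv_K0 It)) (is_mxderiv_cst (K t0 *m f t0) t).
suff -> : gam t *m f t =
    - (invmx (K t) *m - (K t *m gam t) *m invmx (K t)) *m (K t0 *m f t0)
    + invmx (K t) *m 0 by [].
have := fE t It; have := uK t It.
move: (K t) (K t0) (gam t) (f t0) => A A0 G v uA ->.
by rewrite mulmxN !mulNmx opprK mulmx0 addr0 mulKmx// !mulmxA.
Qed.

End Gauge.
Theorem mainTheorem6 (R : realType) (I : set R) (t0 : R)
    (gam : R -> 'M[R[i]%C]_2) (uqq ugg : R -> R[i]%C)
    (Iopen : open I) (Iitv : is_interval I) (It0 : I t0)
    (gam_der : forall t, I t -> mxderivable gam t)
    (gam_qg : forall t, I t -> gam t qk gl != 0)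
    (gam_gq : forall t, I t -> gam t gl qk != 0)
    (uqq_eq : forall t, I t -> second_order_eq gam qk gl uqq t)
    (ugg_eq : forall t, I t -> second_order_eq gam gl qk ugg t) :
  let K := K0 t0 gam uqq ugg in
  let w := fun t => W gam uqq ugg t / (gam t qk gl * gam t gl qk) in
  (* (i) *)
  [/\ (forall t, I t -> is_mxderiv K t (- (K t *m gam t))) /\
      (forall t, I t -> K t \in unitmx -> gauge_transform K gam t = 0),
  (* (ii) *)
      (forall t, I t -> is_cderiv w t 0) /\
      (forall J : set R, is_interval J -> J `<=` I ->
        (forall s, J s -> cderiv uqq s != 0) ->
        forall t1 t, J t1 -> J t ->
          ugg t = quad_ugg t0 gam uqq (w t1) (ugg t1) t1 t),
  (* (iii) *)
      (exists c : R[i]%C, forall t, I t ->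
        \det (K t) = c * cexp (- cint (fun s => \tr (gam s)) t0 t)) /\
      (\det (K t0) != 0 -> forall t, I t -> \det (K t) != 0) &
  (* (iv) *)
      \det (K t0) != 0 ->
      forall f : R -> 'cV[R[i]%C]_2,
        (forall t, I t -> is_mxderiv f t (gam t *m f t)) <->
        (forall t, I t -> f t = invmx (K t) *m K t0 *m f t0)].
Proof.
move=> K w.
have dK := is_mxderiv_K0 Iopen Iitv It0 gam_der gam_qg gam_gq uqq_eq ugg_eq.
have detK := det_K0 Iopen Iitv It0 gam_der gam_qg gam_gq uqq_eq ugg_eq.
split.
- split=> [t It|t It uK]; first exact: dK.
  (* Substituting K' = - K gam makes the two terms of the transformed kernel opposite. *)
  by rewrite /gauge_transform (dK t It).2 mulNmx addrN.
- split=> [t It|].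
    exact: (is_cderiv_wronskian Iopen gam_der gam_qg gam_gq uqq_eq ugg_eq It).
  exact: (ugg_quadrature Iopen Iitv It0 gam_der gam_qg gam_gq uqq_eq ugg_eq).
- split; first by exists (w t0) => t It; exact: detK.
  move=> d0 t It; rewrite detK// mulf_neq0 ?cexp_neq0//.
  by apply: contra d0; rewrite detK// => /eqP->; rewrite mul0r.
- exact: (evolution_solution Iopen Iitv It0 gam_der gam_qg gam_gq uqq_eq ugg_eq).
Qed.
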